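(* For every odd positive integer $n$, there exist a $\mathrm{TOC}_4(7^n+1,5,3)$ and a $\mathrm{TOC}_3(8^n+1,5,3)$.
   Context: $\mathcal{H}_q(n,w)$ is the set of all words of length $n$ over $\mathbb{Z}_q$ with exactly $w$ nonzero entries, with the Hamming distance. An $(n,d,w)_q$-code is a nonempty subset of $\mathcal{H}_q(n,w)$ in which any two distinct words have Hamming distance at least $d$; $A_q(n,d,w)$ is the maximum size of such a code and a code of this size is optimal. A $\mathrm{TOC}_q(n,d,w)$ is a partition of $\mathcal{H}_q(n,w)$ into mutually disjoint optimal $(n,d,w)_q$-codes. *)

(* Defs.v *)
From mathcomp Require Import all_boot.
Set Implicit Arguments. Unset Strict Implicit. Unset Printing Implicit Defensive.

(* Words of length n over Z_q, represented with the alphabet 'I_q = {0,...,q-1}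
   (the ring structure of Z_q is irrelevant here; only "zero" matters). *)
Definition word (q n : nat) := {ffun 'I_n -> 'I_q}.

Definition wt (q n : nat) (x : word q n) : nat := #|[set i | val (x i) != 0]|.

Definition hdist (q n : nat) (x y : word q n) : nat := #|[set i | x i != y i]|.

Definition Hset (q n w : nat) : {set word q n} := [set x | wt x == w].

Definition is_code (q n d w : nat) (C : {set word q n}) : bool :=
  [&& C != set0, C \subset Hset q n w &
      [forall x in C, forall y in C, (x != y) ==> (d <= hdist x y)]].

Definition Aq (q n d w : nat) : nat :=
  \max_(C : {set word q n} | is_code d w C) #|C|.

Definition optimal_code (q n d w : nat) (C : {set word q n}) : bool :=
  is_code d w C && (#|C| == Aq q n d w).

Definition is_TOC (q n d w : nat) (P : {set {set word q n}}) : bool :=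
  partition P (Hset q n w) && [forall C in P, optimal_code d w C].

Definition TOC_exists (q n d w : nat) : Prop :=
  exists P : {set {set word q n}}, is_TOC d w P.

(* Main.v *)
Require Import Defs.
From mathcomp Require Import all_boot.
From mathcomp Require Import all_algebra cyclic finfield.
From mathcomp Require Import zify ring.
Set Implicit Arguments. Unset Strict Implicit. Unset Printing Implicit Defensive.
Import GRing.Theory.

(* Two words of weight 3 are at distance at least 5 iff their supports share at
   most one coordinate, where the symbols differ; so a code over s + 1 symbols
   uses each pair (coordinate, nonzero symbol) once and has at most N s / 3
   words. Hence a colouring of all words of weight 3 with |H| / (N s / 3)
   colours whose classes are codes is a TOC: all classes are optimal by counting.

   Let Q = q^n with n odd, F = GF(Q), E = GF(Q^2). Each w in E \ F gives a
   bijection x |-> (x - w^Q) / (x - w) from the projective line over F onto the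
   (Q+1)-st roots of unity, and the cosets of the (q+1)-st roots of unity pull
   back to a partition of the line into blocks of size q + 1. These blocks are
   the sublines over GF(q): four points of a block have their cross ratio in
   GF(q), so three points determine their block. Three given points lie in a
   common block for exactly q (q - 1) of the Q (Q - 1) values of w, and w, w^Q
   give the same partition. So if the words of length q + 1 are coloured with
   (q (q - 1) / 2) s^2 colours, a word of length Q + 1 is coloured by restricting
   it to the block of its support and letting the first component of its colour
   choose one of the q (q - 1) / 2 partitions containing that block. For q = 7,
   s = 3 and for q = 8, s = 2 the small colouring is explicit. *)

(** * Codes of weight 3 and distance 5 *)

Definition supp (q n : nat) (x : word q n) : {set 'I_n} :=
  [set i | val (x i) != 0].

Definition proper_coloring (q n d w : nat) (K : Type) (c : word q n -> K) :=
  {in Hset q n w &, forall x y, c x = c y -> x != y -> d <= hdist x y}.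

Lemma card_Hset (q n w : nat) : #|Hset q.+1 n w| = 'C(n, w) * q ^ w.
Proof.
rewrite -sum1_card (partition_big (@supp q.+1 n) (fun A => #|A| == w)) /=; last first.
  by move=> x; rewrite inE.
rewrite (eq_bigr (fun=> q ^ w)) => [|A /eqP cA].
  by rewrite sum_nat_const; have := card_draws 'I_n w; rewrite card_ord cardsE => <-.
rewrite sum1_card.
have -> : q ^ w = #|pffun_on (@ord0 q) (mem A) (predC1 (@ord0 q))|.
  by rewrite card_pffun_on cA cardC1 card_ord.
apply: eq_card => x; rewrite !inE; apply/andP/pffun_onP.
  move=> [_ /eqP sxA]; split.
    by apply/subsetP => i; rewrite -sxA !inE.
  by move=> y /imageP[i]; rewrite /= -sxA !inE => xi ->.
move=> [/subsetP s1 s2].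
have sxA : supp x = A.
  apply/setP => i; rewrite inE; apply/idP/idP => [xi|iA]; first exact: s1.
  have := s2 (x i); rewrite !inE; apply; exact: image_f.
by rewrite sxA /Hset inE /wt -/(supp x) sxA cA !eqxx.
Qed.

(** The differing coordinates lie in the union of the supports minus [i], and that union is already
    smaller than the sum of the weights because [i] is shared. *)
Lemma hdist_le_supp (q n : nat) (x y : word q.+1 n) (i : 'I_n) :
  i \in supp x -> x i = y i -> (hdist x y).+2 <= wt x + wt y.
Proof.
move=> xi xy.
have yi : i \in supp y by rewrite inE -xy; rewrite inE in xi.
have sub : [set j | x j != y j] \subset (supp x :|: supp y) :\ i.
  apply/subsetP => j; rewrite !inE => nxy; apply/andP; split.
    by apply: contraNneq nxy => ->; apply/eqP.
  rewrite -negb_and; apply: contra nxy => /andP[/eqP x0 /eqP y0].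
  by apply/eqP/val_inj; rewrite /= x0 y0.
have := subset_leq_card sub; have := cardsD1 i (supp x :|: supp y).
have := cardsUI (supp x) (supp y); rewrite in_setU xi /=.
have : 0 < #|supp x :&: supp y| by apply/card_gt0P; exists i; rewrite inE xi.
move=> I0 e1 e2 le; rewrite /wt -/(supp x) -/(supp y) -e1 e2 add1n addSn ltnS -addn1.
exact: leq_add.
Qed.

Lemma card_code_le (q n : nat) (C : {set word q.+1 n}) :
  C \subset Hset q.+1 n 3 ->
  {in C &, forall x y, x != y -> 5 <= hdist x y} -> #|C| * 3 <= n * q.
Proof.
move=> /subsetP CH dC.
pose S := [set p : word q.+1 n * 'I_n | (p.1 \in C) && (p.2 \in supp p.1)].
have cS : #|S| = #|C| * 3.
  rewrite -sum1_card (partition_big fst (mem C)) /=; last first.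
    by move=> [x i]; rewrite inE => /andP[].
  rewrite (eq_bigr (fun=> 3)) ?sum_nat_const // => x xC.
  have := CH _ xC; rewrite inE => /eqP <-.
  have pinj : injective (fun i : 'I_n => (x, i)) by move=> i j [].
  rewrite sum1dep_card /wt -/(supp x) -(card_imset _ pinj).
  apply: eq_card => -[y i]; rewrite !inE /=; apply/andP/imsetP.
    by move=> [/andP[_ yi] /eqP e]; subst y; exists i => //; rewrite inE.
  by move=> [j xj [-> ->]]; rewrite inE in xj; rewrite eqxx xC xj.
(* Codewords agreeing at a common support coordinate would be at distance at most 3 + 3 - 2 = 4, so
   [f] is injective on [S]. *)
pose f (p : word q.+1 n * 'I_n) := (p.2, p.1 p.2).
have finj : {in S &, injective f}.
  move=> [x i] [y j]; rewrite !inE /= => /andP[xC xi] /andP[yC yj] [e]; subst j.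
  move=> exy; congr pair; apply/eqP; apply: contraT => nxy.
  have := dC _ _ xC yC nxy; have := @hdist_le_supp _ _ x y i.
  rewrite inE xi => /(_ isT exy).
  by have := CH _ xC; have := CH _ yC; rewrite !inE => /eqP -> /eqP -> ; lia.
rewrite -cS -(card_in_imset finj).
have -> : n * q = #|setX [set: 'I_n] [set~ (@ord0 q)]|.
  by rewrite cardsX cardsT cardsC1 !card_ord.
apply/subset_leq_card/subsetP => p /imsetP[[x i]]; rewrite inE /= => /andP[xC xi] ->.
by rewrite !inE /=; rewrite inE in xi.
Qed.

Lemma TOC_of_coloring (q n M : nat) (K : finType) (A : {set K})
    (c : word q.+1 n -> K) :
  0 < M -> M * 3 = n * q -> {in Hset q.+1 n 3, forall x, c x \in A} ->
  #|A| * M = #|Hset q.+1 n 3| -> proper_coloring 5 3 c ->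
  TOC_exists q.+1 n 5 3.
Proof.
move=> M0 M3 cA cardA cP; set H := Hset q.+1 n 3.
pose cl a := [set x in H | c x == a].
have code_le (C : {set word q.+1 n}) :
    C \subset H -> {in C &, forall x y, x != y -> 5 <= hdist x y} ->
    #|C| <= M.
  by move=> CH dC; have := card_code_le CH dC; lia.
have cl_le a : #|cl a| <= M.
  apply: code_le; first by apply/subsetP => x; rewrite inE => /andP[].
  move=> x y; rewrite !inE => /andP[xH /eqP xa] /andP[yH /eqP ya].
  by apply: cP; rewrite ?inE // xa ya.
(* One class below [M], with the others at most [M], would make the total too small. *)
have cl_eq a : a \in A -> #|cl a| = M.
  move=> aA; apply/eqP; rewrite eqn_leq cl_le /= leqNgt; apply/negP => lt.
  have : #|H| < #|A| * M.
    rewrite -sum1_card (partition_big c (mem A)) //= -sum_nat_const.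
    rewrite (bigD1 a) // [X in _ < X](bigD1 a) //= -addSn leq_add //.
      by rewrite sum1dep_card.
    by apply: leq_sum => b _; rewrite sum1dep_card; apply: cl_le.
  by rewrite cardA ltnn.
have cl_code a : a \in A -> is_code 5 3 (cl a).
  move=> aA; apply/and3P; split.
  - by rewrite -card_gt0 cl_eq.
  - by apply/subsetP => x; rewrite inE => /andP[].
  - apply/forall_inP => x xa; apply/forall_inP => y ya; apply/implyP.
    move: xa ya; rewrite !inE => /andP[xH /eqP xa] /andP[yH /eqP ya].
    by apply: cP; rewrite ?inE // xa ya.
have AqM a : a \in A -> Aq q.+1 n 5 3 = M.
  move=> aA; apply/eqP; rewrite eqn_leq; apply/andP; split.
    apply/bigmax_leqP => C /and3P[_ CH /forall_inP dC]; apply: code_le => // x y xC yC nxy.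
    by move/forall_inP: (dC _ xC) => /(_ _ yC); rewrite nxy.
  by rewrite -(cl_eq a aA); apply: (leq_bigmax_cond _ (cl_code a aA)).
exists (preim_partition c H); apply/andP; split; first exact: preim_partitionP.
apply/forall_inP => B /imsetP[x xH ->].
have -> : [set y in H | c x == c y] = cl (c x).
  by apply/setP => y; rewrite !inE [c x == _]eq_sym.
by rewrite /optimal_code cl_code ?cA // cl_eq ?cA // (AqM (c x)) ?cA /=.
Qed.

(** * Colourings in lengths 8 and 9 *)

Definition seq_of_word (q n : nat) (x : word q n) : seq nat :=
  [seq val (x i) | i <- enum 'I_n].

Definition seq_dist (u v : seq nat) := count (fun p => p.1 != p.2) (zip u v).

Fixpoint seqs_of_weight (q n w : nat) : seq (seq nat) :=
  match n, w with
  | 0, 0 => [:: [::]]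
  | 0, _.+1 => [::]
  | n'.+1, 0 => map (cons 0) (seqs_of_weight q n' 0)
  | n'.+1, w'.+1 => map (cons 0) (seqs_of_weight q n' w)
      ++ [seq a :: u | a <- iota 1 q, u <- seqs_of_weight q n' w']
  end.

Lemma mem_seqs_of_weight (q : nat) (u : seq nat) :
  all (leq^~ q) u ->
  u \in seqs_of_weight q (size u) (count (fun a => a != 0) u).
Proof.
elim: u => //= a u IH /andP[aq /IH{}IH].
case: a aq => [|a] aq /=; last first.
  rewrite add1n mem_cat; apply/orP; right; apply/allpairsP; exists (a.+1, u).
  by rewrite mem_iota /= add1n ltnS.
rewrite add0n; case: (count _ u) IH => [|w] IH; first exact: map_f.
by rewrite mem_cat map_f.
Qed.

Lemma count_enum_ord (n : nat) (P : pred 'I_n) :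
  count P (enum 'I_n) = #|[set i | P i]|.
Proof.
rewrite cardE enumT /enum_mem size_filter.
by apply: eq_count => i; rewrite !inE.
Qed.

Lemma seq_of_word_in (q n w : nat) (x : word q.+1 n) :
  x \in Hset q.+1 n w -> seq_of_word x \in seqs_of_weight q n w.
Proof.
rewrite inE => /eqP wx.
have -> : seqs_of_weight q n w = seqs_of_weight q (size (seq_of_word x))
    (count (fun a => a != 0) (seq_of_word x)).
  by rewrite size_map size_enum_ord count_map count_enum_ord -wx.
apply: mem_seqs_of_weight; apply/allP => _ /mapP[i _ ->].
by rewrite -ltnS ltn_ord.
Qed.

Lemma seq_dist_word (q n : nat) (x y : word q n) :
  seq_dist (seq_of_word x) (seq_of_word y) = hdist x y.
Proof. by rewrite /seq_dist zip_map count_map count_enum_ord. Qed.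

Lemma seq_of_word_inj (q n : nat) : injective (@seq_of_word q n).
Proof.
move=> x y /eq_in_map e; apply/ffunP => i; apply: val_inj.
by apply: e; rewrite mem_enum.
Qed.

Definition seq_code (d : nat) (C : seq (seq nat)) :=
  all (fun u => all (fun v => (u == v) || (d <= seq_dist u v)) C) C.

(** The colour of a word is the position of the first list containing it, which settles any overlap
    between lists. *)
Lemma coloring_of_seq_codes (q n d w : nat) (L : seq (seq (seq nat))) :
  all (fun u => has (fun C => u \in C) L) (seqs_of_weight q n w) ->
  all (seq_code d) L ->
  exists2 c : word q.+1 n -> nat,
    {in Hset q.+1 n w, forall x, c x < size L} & proper_coloring d w c.
Proof.
move=> /allP cov /allP codeL.
pose in_code (x : word q.+1 n) (C : seq (seq nat)) := seq_of_word x \in C.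
have hasC x : x \in Hset q.+1 n w -> has (in_code x) L.
  by move=> xH; apply: cov; apply: seq_of_word_in.
exists (fun x => find (in_code x) L) => [x xH|x y xH yH exy nxy].
  by rewrite -has_find hasC.
have xC := nth_find [::] (hasC x xH); have yC := nth_find [::] (hasC y yH).
rewrite -exy in yC.
have := codeL _ (mem_nth [::] (etrans (esym (has_find _ _)) (hasC x xH))).
move=> /allP /(_ _ xC) /allP /(_ _ yC).
by rewrite (inj_eq (@seq_of_word_inj _ _)) (negPf nxy) seq_dist_word.
Qed.

(* Nonzero symbols [a.+1] are read as [a] in Z_q; the word added to them is the
   combination with coefficients [v] of the rows of the matrix of columns [cols]. *)
Definition shift_symbols (q : nat) (cols : seq (seq nat)) (v u : seq nat) :=
  [seq if p.1 is a.+1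
       then ((a + sumn [seq z.1 * z.2 | z <- zip p.2 v]) %% q).+1 else 0
  | p <- zip u cols].

Definition rot7 (i : nat) (u : seq nat) := rot i (take 7 u) ++ drop 7 u.

(** Rotations and symbol shifts are isometries, so all [7 * q ^ 3] images of a base code are
    codes. *)
Definition develop (q : nat) (base : seq (seq nat)) (cols : seq (seq nat)) :=
  [seq [seq rot7 iv.1 (shift_symbols q cols iv.2 u) | u <- base]
  | iv <- [seq (i, v) | i <- iota 0 7,
           v <- [seq a :: v | a <- iota 0 q,
                 v <- [seq [:: b; c] | b <- iota 0 q, c <- iota 0 q]]]].

(* The supports of the base words represent each orbit of Z_7 (acting on the
   first seven coordinates) on the triples once, and the three columns of [cols]
   at each support are independent modulo q, so that every word is reached.
   Found by computer search; for length 8 the supports form the Moebius-Kantor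
   configuration, for length 9 two configurations share the twelve orbits. *)
Definition codes8 := develop 3
  [:: [:: 1; 1; 1; 0; 0; 0; 0; 0]; [:: 0; 0; 2; 1; 0; 1; 0; 0];
      [:: 0; 2; 0; 0; 1; 2; 0; 0]; [:: 2; 0; 0; 0; 2; 0; 1; 0];
      [:: 0; 0; 0; 2; 3; 0; 0; 1]; [:: 0; 3; 0; 3; 0; 0; 2; 0];
      [:: 3; 0; 0; 0; 0; 3; 0; 2]; [:: 0; 0; 3; 0; 0; 0; 3; 3]]
  [:: [:: 0; 2; 1]; [:: 2; 1; 0]; [:: 0; 2; 0]; [:: 2; 2; 1];
      [:: 0; 0; 1]; [:: 2; 2; 2]; [:: 2; 2; 2]; [:: 1; 2; 2]].

Definition codes9 := develop 2
  [:: [:: 1; 1; 1; 0; 0; 0; 0; 0; 0]; [:: 0; 0; 2; 1; 0; 1; 0; 0; 0];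
      [:: 2; 0; 0; 2; 1; 0; 0; 0; 0]; [:: 0; 0; 0; 0; 0; 2; 1; 1; 0];
      [:: 0; 0; 0; 0; 2; 0; 2; 0; 1]; [:: 0; 2; 0; 0; 0; 0; 0; 2; 2]]
  [:: [:: 1; 1; 0]; [:: 1; 0; 1]; [:: 0; 1; 0]; [:: 0; 1; 1]; [:: 1; 1; 1];
      [:: 1; 0; 1]; [:: 0; 1; 0]; [:: 1; 1; 0]; [:: 1; 0; 0]]
  ++ develop 2
  [:: [:: 1; 1; 0; 0; 0; 1; 0; 0; 0]; [:: 0; 2; 1; 0; 0; 0; 0; 0; 1];
      [:: 0; 0; 2; 0; 1; 0; 1; 0; 0]; [:: 0; 0; 0; 1; 0; 2; 0; 1; 0];
      [:: 2; 0; 0; 0; 2; 0; 0; 2; 0]; [:: 0; 0; 0; 2; 0; 0; 2; 0; 2]]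
  [:: [:: 1; 1; 0]; [:: 1; 0; 0]; [:: 1; 1; 0]; [:: 1; 0; 1]; [:: 0; 1; 0];
      [:: 0; 1; 1]; [:: 1; 1; 1]; [:: 0; 0; 1]; [:: 0; 0; 1]].

Lemma coloring8 : exists2 c : word 4 8 -> nat,
  {in Hset 4 8 3, forall x, c x < 21 * 9} & proper_coloring 5 3 c.
Proof.
(* 21 = 7 * 6 / 2 and 9 = 3 ^ 2; the product is also the 7 * 3 ^ 3 developed lists. *)
have -> : 21 * 9 = size codes8 by vm_compute.
by apply: coloring_of_seq_codes; vm_compute.
Qed.

Lemma coloring9 : exists2 c : word 3 9 -> nat,
  {in Hset 3 9 3, forall x, c x < 28 * 4} & proper_coloring 5 3 c.
Proof.
(* 28 = 8 * 7 / 2 and 4 = 2 ^ 2; each of the two developments gives 7 * 2 ^ 3 = 56 lists. *)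
have -> : 28 * 4 = size codes9 by vm_compute.
by apply: coloring_of_seq_codes; vm_compute.
Qed.

(** * Lifting a colouring along a family of partitions *)

Section Restriction.
Variables (q n b : nat).
Implicit Types (x y : word q.+1 n.+1) (B : {set 'I_n.+1}).

Definition restrict x B : word q.+1 b :=
  [ffun i : 'I_b => x (nth ord0 (enum B) i)].

Lemma card_nth_enum (A B : {set 'I_n.+1}) :
  #|B| = b -> A \subset B ->
  #|[set i : 'I_b | nth ord0 (enum B) i \in A]| = #|A|.
Proof.
move=> cB /subsetP AB.
have finj : injective (fun i : 'I_b => nth ord0 (enum B) i).
  move=> i j /eqP; rewrite nth_uniq ?enum_uniq -?cardE ?cB // => /eqP.
  exact: val_inj.
rewrite -(card_imset _ finj); apply: eq_card => z; apply/imsetP/idP.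
  by move=> [i]; rewrite inE => ? ->.
move=> zA; have zB : z \in enum B by rewrite mem_enum AB.
have zlt : index z (enum B) < b by rewrite -cB cardE index_mem.
by exists (Ordinal zlt); rewrite ?inE /= nth_index.
Qed.

Lemma wt_restrict x B : #|B| = b -> supp x \subset B -> wt (restrict x B) = wt x.
Proof.
move=> cB xB; rewrite /wt -/(supp x) -(card_nth_enum cB xB).
by apply: eq_card => i; rewrite !inE ffunE.
Qed.

Lemma hdist_restrict x y B : #|B| = b -> supp x \subset B -> supp y \subset B ->
  hdist (restrict x B) (restrict y B) = hdist x y.
Proof.
move=> cB /subsetP xB /subsetP yB.
have sub : [set i | x i != y i] \subset B.
  apply/subsetP => i; rewrite inE; apply: contraR => iB.
  have := contra (xB i) iB; have := contra (yB i) iB.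
  rewrite !inE !negbK => /eqP yi /eqP xi; apply/eqP/val_inj.
  by rewrite /= xi yi.
rewrite /hdist -(card_nth_enum cB sub).
by apply: eq_card => i; rewrite !inE !ffunE.
Qed.

Lemma hdist_disjoint x y : [disjoint supp x & supp y] -> hdist x y = wt x + wt y.
Proof.
move=> dxy; rewrite /wt -/(supp x) -/(supp y) -cardsUI.
have /eqP -> : supp x :&: supp y == set0 by rewrite setI_eq0.
rewrite cards0 addn0; apply: eq_card => i.
have := disjointFr dxy (x := i); rewrite !inE => dxyi.
have [xi|/negPn/eqP xi] := boolP (val (x i) != 0).
  have /negbFE/eqP yi := dxyi xi.
  by rewrite /=; apply: contraNneq xi => ->; rewrite yi.
by rewrite -val_eqE /= in xi *; rewrite xi eq_sym.
Qed.

End Restriction.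

Lemma cards3_seq (T : finType) (A : {set T}) : #|A| = 3 ->
  exists x y z, uniq [:: x; y; z] /\ A =i [:: x; y; z].
Proof.
rewrite cardE => sA; have := enum_uniq (mem A); have := mem_enum (mem A).
case: (enum _) sA => [|x [|y [|z []]]] //= _ eA uA.
by exists x, y, z; split=> // a; rewrite eA.
Qed.

Section LiftColoring.
Variables (q n b m t : nat) (T : finType) (K : eqType).
Variables (t0 : T) (I : {set T}) (key : T -> 'I_n.+1 -> K).

(** The partition with index [i] is encoded by the level sets of [key i], which makes its blocks
    disjoint by construction. *)
Definition fiber i x := [set y | key i y == key i x].

Hypothesis m_gt0 : 0 < m.
Hypothesis card_fiber : {in I, forall i x, #|fiber i x| = b}.
Hypothesis fiber_unique : {in I &, forall i j x y z, uniq [:: x; y; z] ->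
  y \in fiber i x -> z \in fiber i x -> y \in fiber j x -> z \in fiber j x ->
  fiber i x = fiber j x}.
Hypothesis card_through : forall x y z, uniq [:: x; y; z] ->
  m <= #|[set i in I | (y \in fiber i x) && (z \in fiber i x)]|.

Lemma fiber_eq i x y : y \in fiber i x -> fiber i y = fiber i x.
Proof. by rewrite inE => /eqP e; apply/setP => z; rewrite !inE e. Qed.

Definition block (x : word q.+1 n.+1) : {set 'I_n.+1} :=
  if [pick p : T * 'I_n.+1 | (p.1 \in I) && (supp x \subset fiber p.1 p.2)]
  is Some p then fiber p.1 p.2 else set0.

Definition classes_of (B : {set 'I_n.+1}) : {set T} :=
  [set i in I | [exists x, B == fiber i x]].

(** By [card_through], at least [m] indices put the three support points in one fiber, so [pick]
    succeeds; by [fiber_unique], that fiber is the same for all of them. *)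
Lemma blockP x : x \in Hset q.+1 n.+1 3 ->
  [/\ supp x \subset block x, #|block x| = b & m <= #|classes_of (block x)|].
Proof.
rewrite inE => /eqP /cards3_seq[a [a' [a'' [Ua eA]]]].
have subP i : reflect (exists c, supp x \subset fiber i c)
    ((a' \in fiber i a) && (a'' \in fiber i a)).
  apply: (iffP andP) => [[a1 a2]|[c /subsetP sc]].
    exists a; apply/subsetP => e; rewrite eA !inE => /or3P[] /eqP -> //.
      by move: a1; rewrite inE.
    by move: a2; rewrite inE.
  have [ac a'c a''c] : [/\ a \in fiber i c, a' \in fiber i c & a'' \in fiber i c].
    by split; apply: sc; rewrite eA !inE eqxx ?orbT.
  by rewrite (fiber_eq ac).
have := card_through Ua; rewrite /block; case: pickP => [[i c]|no].
  move=> /= /andP[iI xc] le; split=> //; first exact: card_fiber.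
  have /subP/andP[ia' ia''] : exists c, supp x \subset fiber i c by exists c.
  have ac : a \in fiber i c by apply: (subsetP xc); rewrite eA inE eqxx.
  rewrite -(fiber_eq ac); apply: (leq_trans le); apply/subset_leq_card/subsetP => j.
  rewrite inE => /and3P[jI ja' ja'']; rewrite inE jI /=.
  apply/existsP; exists a; apply/eqP.
  exact: (fiber_unique iI jI Ua).
move=> le; have /card_gt0P[i] := leq_trans m_gt0 le.
rewrite inE => /andP[iI /subP[c xc]].
by have := no (i, c); rewrite /= iI xc.
Qed.

Variable c : word q.+1 b -> nat.
Hypothesis c_lt : {in Hset q.+1 b 3, forall x, c x < m * t.+1}.
Hypothesis c_proper : proper_coloring 5 3 c.

(** Division by [t.+1] splits a colour into a quotient below [m], selecting a partition that
    contains the block, and a remainder. For words of weight 3 the default [t0] is never read. *)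
Definition lift_coloring (x : word q.+1 n.+1) : T * 'I_t.+1 :=
  let a := c (restrict b x (block x)) in
  (nth t0 (enum (classes_of (block x))) (a %/ t.+1), inord (a %% t.+1)).

Lemma restrict_block x : x \in Hset q.+1 n.+1 3 ->
  restrict b x (block x) \in Hset q.+1 b 3.
Proof.
by move=> xH; have [xB cB _] := blockP xH; rewrite inE wt_restrict //; move: xH; rewrite inE.
Qed.

Lemma lift_index_lt x : x \in Hset q.+1 n.+1 3 ->
  c (restrict b x (block x)) %/ t.+1 < size (enum (classes_of (block x))).
Proof.
move=> xH; have [_ _ le] := blockP xH; rewrite -cardE.
apply: leq_trans le; rewrite ltn_divLR //; exact: c_lt (restrict_block xH).
Qed.

Lemma lift_coloring_class x : x \in Hset q.+1 n.+1 3 ->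
  (lift_coloring x).1 \in classes_of (block x).
Proof. by move=> xH; rewrite -mem_enum mem_nth ?lift_index_lt. Qed.

Lemma lift_coloring_in x : x \in Hset q.+1 n.+1 3 ->
  lift_coloring x \in setX I [set: 'I_t.+1].
Proof.
move=> /lift_coloring_class; rewrite in_setX inE => /andP[-> _].
by rewrite inE.
Qed.

Lemma lift_coloring_proper : proper_coloring 5 3 lift_coloring.
Proof.
move=> x y xH yH exy nxy.
have [xB cB _] := blockP xH; have [yB _ _] := blockP yH.
have := lift_coloring_class xH; have := lift_coloring_class yH; rewrite exy.
rewrite !inE => /andP[_ /existsP[v /eqP By]] /andP[_ /existsP[u /eqP Bx]].
(* In a common block, quotient and remainder agree, so the restrictions have the same colour under
   [c]. *)
have [eB|nB] := eqVneq (block x) (block y).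
  have xr := restrict_block xH; have yr := restrict_block yH.
  have hlx := lift_index_lt xH; have hly := lift_index_lt yH.
  move: exy; rewrite /lift_coloring eB => -[/eqP].
  rewrite -eB nth_uniq ?enum_uniq ?eB // -?eB // ?[in X in _ < X]eB // => /eqP e1 e2.
  have {}e2 := congr1 val e2; move: e2; rewrite /= !inordK ?ltn_pmod // => e2.
  rewrite -eB in yB; rewrite -(hdist_restrict cB xB yB).
  rewrite -eB in yr e1 e2; apply: c_proper => //.
    by rewrite (divn_eq (c _) t.+1) e1 e2 -divn_eq.
  apply: contraNneq nxy => er; apply/eqP/ffunP => i; apply: contraTeq isT => ni.
  have := hdist_restrict cB xB yB; rewrite er /hdist => /esym/eqP.
  rewrite [X in _ == X](_ : _ = 0); last by apply: eq_card0 => j; rewrite !inE eqxx.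
  by rewrite cards_eq0 => /eqP/setP/(_ i); rewrite !inE ni.
(* Distinct blocks of the same partition are disjoint, so the distance is 3 + 3. *)
rewrite hdist_disjoint.
  by move: xH yH; rewrite !inE => /eqP -> /eqP ->.
apply: disjointWl xB _; apply: disjointWr yB _.
rewrite Bx By; apply/pred0P => z /=; apply/negP => /andP[zu zv].
by move: nB; rewrite Bx By -(fiber_eq zu) -(fiber_eq zv) eqxx.
Qed.

End LiftColoring.

(** * Sublines of a projective line over a finite field *)

Section UnityRoots.
Local Open Scope ring_scope.
Variable E : finFieldType.

Definition unity_roots (d : nat) := [set x : E | x ^+ d == 1].

Lemma card_unity_roots_le (d : nat) : (0 < d)%N -> (#|unity_roots d| <= d)%N.
Proof.
move=> d0; rewrite cardE; apply: max_unity_roots => //; last exact: enum_uniq.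
by apply/allP => x; rewrite mem_enum inE unity_rootE.
Qed.

Lemma card_unity_roots (d : nat) : (0 < d)%N -> (d %| #|E|.-1)%N ->
  #|unity_roots d| = d.
Proof.
move=> d0 dE; apply/eqP; rewrite eqn_leq card_unity_roots_le //=.
have E1 : (0 < #|E|.-1)%N by have := finNzRing_gt1 E; case: #|_| => [|[]].
have /hasP[z _ zP] : has #|E|.-1.-primitive_root (enum [set~ (0 : E)]).
  apply: has_prim_root; rewrite ?enum_uniq // -?cardE ?cardsC1 //.
  apply/allP => x; rewrite mem_enum !inE unity_rootE => x0.
  rewrite -(inj_eq (mulfI x0)) -exprS prednK ?expf_card ?mulr1 //.
  by apply: ltn_trans (finNzRing_gt1 E).
(* This power [y] of a generator of the multiplicative group has order [d]; its powers are the [d]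
   roots. *)
have zd := dvdn_prim_root zP dE; set y := z ^+ _ in zd.
have yinj : injective (fun i : 'I_d => y ^+ i).
  move=> i j /eqP; rewrite (eq_prim_root_expr zd) !modn_small // => /eqP.
  exact: val_inj.
rewrite -[X in (X <= _)%N]card_ord -cardsT -(card_imset _ yinj).
apply/subset_leq_card/subsetP => _ /imsetP[i _ ->].
by rewrite inE exprAC (prim_expr_order zd) expr1n.
Qed.

Lemma fixed_powerE (d : nat) : [set x : E | x ^+ d.+1 == x] = 0 |: unity_roots d.
Proof.
apply/setP => x; rewrite !inE; have [->|x0] := eqVneq x 0.
  by rewrite expr0n eqxx.
by rewrite exprS -{3}[x]mulr1 (inj_eq (mulfI x0)).
Qed.

Lemma card_fixed_power (d : nat) : (0 < d)%N ->
  #|[set x : E | x ^+ d.+1 == x]| = #|unity_roots d|.+1.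
Proof.
by move=> d0; rewrite fixed_powerE cardsU1 inE expr0n eqn0Ngt d0 eq_sym oner_eq0.
Qed.

End UnityRoots.

(** For [a = 1] and [V] a group of roots of unity, these are the candidate slopes at two further
    points once the slope at a first point is scaled to 1. *)
Definition distinct_pairs (T : finType) (a : T) (V : {set T}) : {set T * T} :=
  [set p | [&& p.1 \in V :\ a, p.2 \in V :\ a & p.1 != p.2]].

Lemma card_distinct_pairs (T : finType) (a : T) (V : {set T}) :
  a \in V -> #|distinct_pairs a V| = (#|V|.-1 * #|V|.-2)%N.
Proof.
move=> aV; have cV : #|V :\ a| = #|V|.-1 by rewrite (cardsD1 a V) aV.
rewrite -sum1_card (partition_big fst (mem (V :\ a))) /=; last first.
  by move=> [x y]; rewrite inE => /and3P[].
rewrite (eq_bigr (fun=> #|V|.-2)) ?sum_nat_const ?cV // => x xV.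
have pinj : injective (fun y : T => (x, y)) by move=> y y' [].
rewrite sum1dep_card.
have -> : #|V|.-2 = #|(V :\ a) :\ x| by rewrite -cV (cardsD1 x) xV.
rewrite -(card_imset _ pinj); apply: eq_card => -[x' y]; rewrite inE /=.
apply/andP/imsetP.
  move=> [/[swap] /eqP ->]; rewrite inE => /and3P[_ yV nxy].
  by exists y => //; rewrite in_setD1 eq_sym nxy.
move=> [y' /setD1P[nyx yV] [-> ->]]; rewrite inE eqxx.
by split=> //; apply/and3P; split=> //; rewrite eq_sym.
Qed.

(* Exactly one element of each orbit of [s] precedes its image in the
   enumeration of [T]. *)
Lemma card_involution_half (T : finType) (s : T -> T) (A : {set T}) :
  involutive s -> {in A, forall x, s x \in A} -> {in A, forall x, s x != x} ->
  #|A| = (#|[set x in A | (enum_rank x < enum_rank (s x))%N]|.*2)%N.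
Proof.
move=> sK sA sn; set B := [set x in A | _].
have -> : A = B :|: s @: B.
  apply/setP => x; apply/idP/setUP => [xA|[|/imsetP[y]]]; last 2 first.
  - by rewrite inE => /andP[].
  - by rewrite inE => /andP[yA _] ->; apply: sA.
  have [lt|lt|/ord_inj/enum_rank_inj e] := ltngtP (enum_rank x) (enum_rank (s x)).
  - by left; rewrite inE xA.
  - by right; apply/imsetP; exists (s x); rewrite ?sK // inE sA // sK.
  - by have := sn x xA; rewrite -e eqxx.
rewrite cardsU (card_imset _ (inv_inj sK)) -addnn.
have -> : B :&: s @: B = set0.
  apply/setP => x; rewrite !inE; apply/negP => /andP[/andP[_ lt] /imsetP[y]].
  by rewrite inE => /andP[_ lt'] e; move: lt; rewrite e sK; lia.
by rewrite cards0 subn0.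
Qed.

Section Lines.
Local Open Scope ring_scope.
Variables (E : finFieldType) (q Q : nat).
Hypothesis q_gt1 : (1 < q)%N.
Hypothesis Q_gt1 : (1 < Q)%N.
Hypothesis q_pchar : [pchar E].-nat q.
Hypothesis Q_pchar : [pchar E].-nat Q.
Hypothesis q1_dvd : (q.+1 %| Q.+1)%N.
Hypothesis card_E : #|E| = (Q ^ 2)%N.

Lemma frobB (m : nat) (x y : E) : [pchar E].-nat m ->
  (x - y) ^+ m = x ^+ m - y ^+ m.
Proof.
by move=> pm; apply: (addIr (y ^+ m)); rewrite -exprDn_pchar // !subrK.
Qed.

Lemma exprQQ (x : E) : x ^+ Q ^+ Q = x.
Proof. by rewrite -exprM mulnn -card_E expf_card. Qed.

Lemma Q1_dvd : (Q.+1 %| #|E|.-1)%N.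
Proof. by rewrite card_E; apply/dvdnP; exists Q.-1; lia. Qed.

Definition subF := [set x : E | x ^+ Q == x].

Lemma card_subF : #|subF| = Q.
Proof.
have Q0 : (0 < Q.-1)%N by lia.
rewrite -[Q in RHS](ltn_predK Q_gt1) -(@card_unity_roots E _ Q0).
  by rewrite -card_fixed_power // (ltn_predK Q_gt1).
by rewrite card_E; apply/dvdnP; exists Q.+1; lia.
Qed.

(* Homogeneous coordinates on the projective line over [subF]; the last
   index is the point at infinity. *)
Definition pt0 (i : 'I_Q.+1) : E := if (i < Q)%N then nth 0 (enum subF) i else 1.
Definition pt1 (i : 'I_Q.+1) : E := if (i < Q)%N then 1 else 0.

Lemma pt0Q i : pt0 i ^+ Q = pt0 i.
Proof.
rewrite /pt0; case: ifP => [iQ|_]; last by rewrite expr1n.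
have : nth 0 (enum subF) i \in subF by rewrite -mem_enum mem_nth // -cardE card_subF.
by rewrite inE => /eqP.
Qed.

Lemma pt1Q i : pt1 i ^+ Q = pt1 i.
Proof. by rewrite /pt1; case: ifP; rewrite ?expr1n // expr0n eqn0Ngt (ltnW Q_gt1). Qed.

(** The determinant of the coordinates of two points; [lin w i] below is the same determinant with
    the point (w : 1) over [E]. *)
Definition bracket i j := pt0 i * pt1 j - pt1 i * pt0 j.

Lemma bracket_neq0 i j : i != j -> bracket i j != 0.
Proof.
rewrite /bracket /pt0 /pt1 -val_eqE /= => nij.
have := ltn_ord i; have := ltn_ord j.
case: ifP => iQ; case: ifP => jQ ji ij;
  rewrite !(mulr0, mulr1, mul0r, mul1r, subr0, sub0r, oppr_eq0)
    ?oner_eq0 //.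
  by rewrite subr_eq0 nth_uniq ?enum_uniq // -cardE card_subF.
lia.
Qed.

Definition lin (w : E) i := pt0 i - w * pt1 i.

Lemma linQ w i : lin w i ^+ Q = lin (w ^+ Q) i.
Proof. by rewrite /lin frobB // exprMn pt0Q pt1Q. Qed.

Definition offF := [set w : E | w ^+ Q != w].

Lemma offFQ w : w \in offF -> w ^+ Q \in offF.
Proof. by rewrite !inE exprQQ eq_sym. Qed.

Lemma card_offF : #|offF| = (Q * Q.-1)%N.
Proof.
have -> : offF = ~: subF by apply/setP => w; rewrite !inE.
by have := cardsC subF; rewrite card_subF cardT -cardE card_E; lia.
Qed.

Lemma lin_neq0 w i : w \in offF -> lin w i != 0.
Proof.
rewrite inE => wF; apply: contraNneq wF; rewrite /lin /pt0 /pt1.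
case: ifP => iQ; last by rewrite mulr0 subr0 => /eqP; rewrite oner_eq0.
have /[!inE]/eqP : nth 0 (enum subF) i \in subF.
  by rewrite -mem_enum mem_nth // -cardE card_subF.
by rewrite mulr1 => eF /eqP; rewrite subr_eq0 => /eqP <-; rewrite eF.
Qed.

(** The Moebius map x |-> (x - w^Q) / (x - w), with value 1 at infinity. *)
Definition slope w i := lin (w ^+ Q) i / lin w i.

Lemma slope_neq0 w i : w \in offF -> slope w i != 0.
Proof. by move=> wF; rewrite mulf_neq0 ?invr_neq0 ?lin_neq0 ?offFQ. Qed.

Lemma slope_conj w i : slope (w ^+ Q) i = (slope w i)^-1.
Proof. by rewrite /slope exprQQ invf_div. Qed.

(** The power [Q] exchanges numerator and denominator, so it inverts the slope. *)
Lemma slopeQ1 w i : w \in offF -> slope w i \in unity_roots E Q.+1.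
Proof.
move=> wF; rewrite inE exprSr /slope expr_div_n !linQ exprQQ.
by rewrite mulf_div [X in _ / X]mulrC divff // mulf_neq0 ?lin_neq0 ?offFQ.
Qed.

Lemma slopeB w i j : w \in offF ->
  slope w i - slope w j = (w ^+ Q - w) * bracket i j / (lin w i * lin w j).
Proof.
move=> wF; have := lin_neq0 i wF; have := lin_neq0 j wF.
rewrite /slope /bracket /lin => nj ni; field; by rewrite ni nj.
Qed.

Lemma slope_inj w : w \in offF -> injective (slope w).
Proof.
move=> wF i j /eqP; rewrite -subr_eq0 slopeB //; apply: contraTeq => nij.
rewrite !mulf_neq0 ?invr_neq0 ?mulf_neq0 ?lin_neq0 ?bracket_neq0 // subr_eq0.
by rewrite inE in wF.
Qed.

Lemma slope_onto w u : w \in offF -> u \in unity_roots E Q.+1 ->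
  exists i, u = slope w i.
Proof.
move=> wF uU.
have : slope w @: [set: 'I_Q.+1] == unity_roots E Q.+1.
  rewrite eqEcard (card_imset _ (slope_inj wF)) cardsT card_ord.
  rewrite card_unity_roots ?Q1_dvd // leqnn andbT.
  by apply/subsetP => _ /imsetP[i _ ->]; apply: slopeQ1.
by move=> /eqP e; move: uU; rewrite -e => /imsetP[i _ ->]; exists i.
Qed.

(** Its level sets are the preimages under [slope w] of the cosets of the (q+1)-st roots of
    unity. *)
Definition key w i := slope w i ^+ q.+1.

Local Notation fiber := (fiber key).

Lemma mem_fiber w i j : w \in offF ->
  (j \in fiber w i) = (slope w j / slope w i \in unity_roots E q.+1).
Proof.
move=> wF; have n0 := expf_neq0 q.+1 (slope_neq0 i wF).
rewrite !inE /key -[RHS](inj_eq (mulIf n0)) -exprMn mul1r.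
by rewrite divfK // slope_neq0.
Qed.

Lemma fiber_conj w i : fiber (w ^+ Q) i = fiber w i.
Proof.
by apply/setP => j; rewrite !inE /key !slope_conj !exprVn (inj_eq invr_inj).
Qed.

Lemma unity_q1_sub : unity_roots E q.+1 \subset unity_roots E Q.+1.
Proof.
case/dvdnP: q1_dvd => k ->; apply/subsetP => u.
by rewrite !inE mulnC exprM => /eqP ->; rewrite expr1n.
Qed.

Lemma card_unity_q1 : #|unity_roots E q.+1| = q.+1.
Proof. by apply: card_unity_roots => //; apply: dvdn_trans q1_dvd Q1_dvd. Qed.

Lemma card_fiber_key w i : w \in offF -> #|fiber w i| = q.+1.
Proof.
move=> wF; rewrite -card_unity_q1 -(card_imset _ (slope_inj wF)).
have minj := mulfI (slope_neq0 i wF).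
rewrite -[RHS](card_imset _ minj); apply: eq_card => u; apply/imsetP/imsetP.
  move=> [j jf ->]; exists (slope w j / slope w i); first by rewrite -mem_fiber.
  by rewrite mulrC divfK // slope_neq0.
move=> [s sU ->]; have [|j ej] := @slope_onto w (slope w i * s) wF.
  have := slopeQ1 i wF; have := subsetP unity_q1_sub _ sU; rewrite !inE.
  by move: (slope w i) => r /eqP sQ /eqP rQ; rewrite exprMn sQ rQ mulr1.
by exists j => //; rewrite mem_fiber // -ej mulrC mulKf // slope_neq0.
Qed.

(* The cross ratio sending [x], [y], [z] to 0, 1, infinity; junk value 0 at [v = z]. *)
Definition cross x y z v := bracket v x * bracket y z / (bracket v z * bracket y x).

(** The slopes have the same cross ratio as the points. On the level set with value [c], the power
    [q] acts on slopes as s |-> c / s, a Moebius map, hence preserves it. *)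
Lemma cross_fixed w x y z v : w \in offF -> uniq [:: x; y; z] -> v != z ->
  y \in fiber w x -> z \in fiber w x -> v \in fiber w x ->
  cross x y z v ^+ q = cross x y z v.
Proof.
move=> wF; rewrite /= !inE negb_or andbT => /andP[/andP[nxy nxz] nyz] nvz.
set c := key w x.
have crossE : cross x y z v = (slope w v - slope w x) * (slope w y - slope w z)
    / ((slope w v - slope w z) * (slope w y - slope w x)).
  rewrite !slopeB // /cross.
  have := bracket_neq0 nvz; have := bracket_neq0 nxy.
  rewrite eq_sym in nxy; have := bracket_neq0 nxy.
  have := lin_neq0 x wF; have := lin_neq0 y wF; have := lin_neq0 z wF.
  have := lin_neq0 v wF; have : w ^+ Q - w != 0 by rewrite subr_eq0; rewrite inE in wF.
  move: (lin w x) (lin w y) (lin w z) (lin w v) (w ^+ Q - w).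
  move: (bracket _ _) (bracket _ _) (bracket _ _) (bracket _ _).
  by move=> *; field; do ![apply/andP; split].
have slopeXq i : key w i == c -> slope w i ^+ q = c / slope w i.
  by move=> /eqP <-; rewrite /key exprSr mulfK // slope_neq0.
move=> /slopeXq ey /slopeXq ez /slopeXq ev; have ex := slopeXq x (eqxx _).
have c0 : c != 0 by rewrite expf_neq0 // slope_neq0.
have n1 : slope w v - slope w z != 0.
  by rewrite subr_eq0 (inj_eq (slope_inj wF)).
have n2 : slope w y - slope w x != 0.
  by rewrite subr_eq0 (inj_eq (slope_inj wF)) eq_sym.
rewrite crossE; move: ex ey ez ev n1 n2.
have := slope_neq0 x wF; have := slope_neq0 y wF; have := slope_neq0 z wF.
have := slope_neq0 v wF; move: (slope w x) (slope w y) (slope w z) (slope w v).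
move=> sx sy sz sv v0 z0 y0 x0 ex ey ez ev n1 n2.
have n3 : c * sx - c * sy != 0 by rewrite -mulrBr mulf_neq0 // -opprB oppr_eq0.
have n4 : c * sz - c * sv != 0 by rewrite -mulrBr mulf_neq0 // -opprB oppr_eq0.
rewrite expr_div_n !exprMn !frobB // ex ey ez ev; field.
by rewrite n1 n2 x0 y0 z0 v0 !mulNr n3 n4.
Qed.

Lemma cross_inj x y z : uniq [:: x; y; z] ->
  {in [set v | v != z] &, injective (cross x y z)}.
Proof.
rewrite /= !inE negb_or andbT => /andP[/andP[nxy nxz] nyz] u v; rewrite !inE => nuz nvz.
rewrite eq_sym in nxy; move=> e.
have := bracket_neq0 nuz; have := bracket_neq0 nvz; have := bracket_neq0 nxy.
have := bracket_neq0 nyz => byz byx bvz buz.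
have : bracket u x * bracket v z = bracket v x * bracket u z.
  have byzx : bracket y z / bracket y x != 0 by rewrite mulf_neq0 ?invr_neq0.
  apply: (mulIf byzx); rewrite /cross in e.
  transitivity ((bracket u x * bracket y z / (bracket u z * bracket y x))
     * (bracket v z * bracket u z)); first by field; rewrite buz byx.
  by rewrite e; field; rewrite bvz byx.
move=> /eqP; rewrite -subr_eq0 => /eqP e'; apply/eqP; apply: contraT => nuv.
(* By the three-term Pluecker relation this product is the difference in [e']. *)
have : bracket u v * bracket x z != 0 by rewrite mulf_neq0 ?bracket_neq0.
by rewrite (_ : _ * _ = 0) ?eqxx // -e' /bracket; ring.
Qed.

(** The right side contains the q + 1 points of the fiber and has at most q + 1 elements, since X^q
    = X has at most q roots. It does not involve [w], so three points determine their block. *)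
Lemma fiber_cross w x y z : w \in offF -> uniq [:: x; y; z] ->
  y \in fiber w x -> z \in fiber w x ->
  fiber w x = z |: [set v | (v != z) && (cross x y z v ^+ q == cross x y z v)].
Proof.
move=> wF U fy fz; apply/eqP; rewrite eqEcard card_fiber_key //; apply/andP; split.
  apply/subsetP => v fv; rewrite in_setU1 inE.
  have [->|nvz] := eqVneq v z; first by [].
  by rewrite (cross_fixed wF U nvz fy fz fv) eqxx.
rewrite cardsU1 inE eqxx /= ltnS -(card_in_imset (f := cross x y z)); last first.
  by apply: sub_in2 (cross_inj U) => v; rewrite !inE => /andP[].
apply: (@leq_trans #|[set k : E | k ^+ q == k]|).
  by apply/subset_leq_card/subsetP => _ /imsetP[v /[!inE] /andP[_ ?] ->].
have q0 : (0 < q.-1)%N by lia.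
rewrite -[q in X in (X <= _)%N](ltn_predK q_gt1) card_fixed_power //.
by have := card_unity_roots_le E q0; lia.
Qed.

(** Lagrange interpolation: times the three brackets, any value of the form is a combination of its
    values at [x], [y], [z]. *)
Lemma quadratic_form_three_zeros (a b c : E) x y z (p0 p1 : E) :
  let B u0 u1 := a * u0 ^+ 2 + b * u0 * u1 + c * u1 ^+ 2 in
  uniq [:: x; y; z] -> B (pt0 x) (pt1 x) = 0 -> B (pt0 y) (pt1 y) = 0 ->
  B (pt0 z) (pt1 z) = 0 -> B p0 p1 = 0.
Proof.
move=> B; rewrite /= !inE negb_or andbT => /andP[/andP[nxy nxz] nyz] Bx By Bz.
apply/eqP; apply: contraT => Bp; rewrite eq_sym in nxz.
have : B p0 p1 * (bracket x y * bracket y z * bracket z x) != 0.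
  by rewrite !mulf_neq0 ?bracket_neq0.
pose bp i := p0 * pt1 i - p1 * pt0 i.
rewrite (_ : _ * _ = - (B (pt0 x) (pt1 x) * (bp y * bp z * bracket y z)
  + B (pt0 y) (pt1 y) * (bp x * bp z * bracket z x)
  + B (pt0 z) (pt1 z) * (bp x * bp y * bracket x y))).
  by rewrite Bx By Bz !mul0r !addr0 oppr0 eqxx.
by rewrite /B /bp /bracket; ring.
Qed.

Definition slope_pair x y z w := (slope w y / slope w x, slope w z / slope w x).

(* The ratios of the slopes determine the Moebius map [v |-> slope w v] up to a
   factor, hence its pole [w]. *)
Lemma slope_pair_inj x y z : uniq [:: x; y; z] ->
  {in offF &, injective (slope_pair x y z)}.
Proof.
move=> U w w' wF w'F [ey ez].
set a := slope w x; set a' := slope w' x.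
have a0 : a != 0 := slope_neq0 x wF; have a'0 : a' != 0 := slope_neq0 x w'F.
(* The form obtained by clearing denominators in [slope w v / a = slope w' v / a']. *)
pose B u0 u1 := (a' - a) * u0 ^+ 2 + (a * (w' ^+ Q + w) - a' * (w ^+ Q + w')) * u0 * u1
   + (a' * w ^+ Q * w' - a * w' ^+ Q * w) * u1 ^+ 2.
have BE v : slope w v / a = slope w' v / a' -> B (pt0 v) (pt1 v) = 0.
  move=> e; have lw := lin_neq0 v wF; have lw' := lin_neq0 v w'F.
  have -> : B (pt0 v) (pt1 v) =
      (lin w v * lin w' v * a * a') * (slope w v / a - slope w' v / a').
    rewrite /slope /B; move: lw lw'; rewrite /lin => lw lw'; field.
    by rewrite a0 a'0 lw lw'.
  by rewrite e subrr mulr0.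
have : B w 1 = 0.
  apply: (quadratic_form_three_zeros _ _ U); apply: BE => //.
  by rewrite !divff.
(* At (w : 1) the term of [B] with the factor [lin w] vanishes. *)
have -> : B w 1 = a' * (w - w ^+ Q) * (w - w') by rewrite /B; ring.
move=> /eqP; apply: contraTeq => nww'.
by rewrite mulf_neq0 ?subr_eq0 // mulf_neq0 // subr_eq0 eq_sym; rewrite inE in wF.
Qed.

(** An injection between sets of the same size Q (Q - 1) is onto. *)
Lemma slope_pair_image x y z : uniq [:: x; y; z] ->
  slope_pair x y z @: offF = distinct_pairs 1 (unity_roots E Q.+1).
Proof.
move=> U; apply/eqP; rewrite eqEcard (card_in_imset (slope_pair_inj U)) card_offF.
rewrite card_distinct_pairs ?inE ?expr1n // card_unity_roots ?Q1_dvd // leqnn andbT.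
move: U; rewrite /= !inE negb_or andbT => /andP[/andP[nxy nxz] nyz].
apply/subsetP => _ /imsetP[w wF ->]; rewrite /slope_pair inE /=.
have x0 := slope_neq0 x wF.
have inU v : slope w v / slope w x \in unity_roots E Q.+1.
  have := slopeQ1 v wF; have := slopeQ1 x wF; rewrite !inE.
  move: (slope w x) (slope w v) => r s /eqP rQ /eqP sQ.
  by rewrite expr_div_n rQ sQ divr1.
have ne u v : u != v -> slope w u / slope w x != slope w v / slope w x.
  by move=> nuv; rewrite (inj_eq (mulIf (invr_neq0 x0))) (inj_eq (slope_inj wF)).
rewrite !in_setD1 !inU ne // -(divff x0) !ne //= eq_sym //.
Qed.

(** The condition says that both slope ratios are (q+1)-st roots of unity, so [slope_pair] matches
    these [w] with the distinct pairs in the smaller group. *)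
Lemma card_offF_through x y z : uniq [:: x; y; z] ->
  #|[set w in offF | (y \in fiber w x) && (z \in fiber w x)]| = (q * q.-1)%N.
Proof.
move=> U; transitivity #|distinct_pairs 1 (unity_roots E q.+1)|; last first.
  by rewrite card_distinct_pairs ?card_unity_q1 // inE expr1n.
rewrite -(card_in_imset (f := slope_pair x y z)); last first.
  by apply: sub_in2 (slope_pair_inj U) => w; rewrite inE => /andP[].
apply: eq_card => p; apply/imsetP/idP.
  move=> [w /setIdP[wF]]; rewrite !mem_fiber // => /andP[yU zU] ->.
  have : slope_pair x y z w \in slope_pair x y z @: offF by apply: imset_f.
  rewrite slope_pair_image // !inE /= => /and3P[/andP[-> _] /andP[-> _] ->].
  by rewrite inE in yU; rewrite inE in zU; rewrite yU zU.
move=> pU; have : p \in distinct_pairs 1 (unity_roots E Q.+1).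
  move: pU; rewrite !inE => /and3P[/andP[-> p1] /andP[-> p2] ->] /=.
  have sub (u : E) : u ^+ q.+1 == 1 -> u ^+ Q.+1 == 1.
    by move=> uq; have := subsetP unity_q1_sub u; rewrite !inE; apply.
  by rewrite !sub.
rewrite -(slope_pair_image U) => /imsetP[w wF ep]; exists w => //.
rewrite inE wF !mem_fiber //=; move: pU; rewrite ep inE /=.
by move=> /and3P[/setD1P[_ ->] /setD1P[_ ->]].
Qed.

(** One element from each pair of conjugates [w], [w ^+ Q], so that no partition is indexed by
    both. *)
Definition half_offF := [set w in offF | (enum_rank w < enum_rank (w ^+ Q))%N].

Lemma card_half (A : {set E}) : A \subset offF -> {in A, forall w, w ^+ Q \in A} ->
  #|A| = (#|A :&: half_offF|.*2)%N.
Proof.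
move=> /subsetP AF AQ; rewrite (card_involution_half exprQQ AQ).
  congr (_.*2)%N; apply: eq_card => w; rewrite !inE; case wA: (w \in A) => //=.
  by have := AF _ wA; rewrite inE => ->.
by move=> w /AF; rewrite inE.
Qed.

Lemma card_half_offF : (#|half_offF|.*2 = Q * Q.-1)%N.
Proof.
rewrite -card_offF (card_half (subxx _)) => [|w]; last exact: offFQ.
by congr (_.*2)%N; apply: eq_card => w; rewrite !inE; case: (_ != _).
Qed.

Lemma card_half_through x y z : uniq [:: x; y; z] ->
  (#|[set w in half_offF | (y \in fiber w x) && (z \in fiber w x)]|.*2 = q * q.-1)%N.
Proof.
move=> U; rewrite -(card_offF_through U) [RHS]card_half; last 2 first.
- by apply/subsetP => w /setIdP[].
- by move=> w /setIdP[wF fyz]; apply/setIdP; rewrite offFQ // !fiber_conj.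
congr (_.*2)%N; apply: eq_card => w; rewrite in_setI !(inE, in_set) /=.
by case: (_ != _); rewrite //= ?andbT ?andbF // andbC.
Qed.

End Lines.

(** * Arithmetic of the parameters and assembly *)

Lemma dvdn_odd_expn_add1 (q n : nat) : odd n -> q.+1 %| (q ^ n).+1.
Proof.
case: q => [|q] on; first exact: dvd1n.
rewrite -(odd_double_half n) on add1n; elim: n./2 => [|j IH].
  by rewrite expn1.
(* With r = q + 1, the subtracted term is r^2 - 1 = (r - 1) (r + 1). *)
have -> : (q.+1 ^ j.+1.*2.+1).+1
    = (q.+1 * q.+1) * (q.+1 ^ j.*2.+1).+1 - q * q.+2.
  by rewrite doubleS !(expnS _ _.+1); lia.
by apply: dvdn_sub; apply: dvdn_mull.
Qed.

Lemma bin3_mul6 (Q : nat) : 'C(Q.+1, 3) * 6 = Q.+1 * (Q * Q.-1).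
Proof. by have := bin_ffact Q.+1 3; rewrite !ffactnS ffactn0 muln1. Qed.

Lemma TOC_projective_line (p k s n : nat) :
  prime p -> 0 < k -> 0 < s -> odd n -> 3 %| (p ^ k).+1 * s ->
  (exists2 c : word s.+1 (p ^ k).+1 -> nat,
    {in Hset s.+1 (p ^ k).+1 3, forall x, c x < (p ^ k * (p ^ k).-1)./2 * s ^ 2} &
    proper_coloring 5 3 c) ->
  TOC_exists s.+1 ((p ^ k) ^ n + 1) 5 3.
Proof.
move=> pp k0 s0 on; set q := p ^ k => d3 [c c_lt cP]; rewrite addn1.
set Q := q ^ n; have n0 : 0 < n by case: n on {Q}.
have q1 : 1 < q by rewrite -(exp1n k) ltn_exp2r // prime_gt1.
have Q1 : 1 < Q by rewrite -(exp1n n) ltn_exp2r.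
have qQ : q.+1 %| Q.+1 by apply: dvdn_odd_expn_add1.
(* Degree [k * n * 2] over the prime field gives [E] the order [Q ^ 2]. *)
have kn0 : 0 < k * n * 2 by rewrite !muln_gt0 k0 n0.
have [E pE cE] := pPrimePowerField pp kn0.
have {}cE : #|E| = Q ^ 2 by rewrite cE !expnM.
have qE : ([pchar E]%R).-nat q.
  by rewrite (eq_pnat _ (pcharf_eq pE)) pnatX pnat_id.
have QE : ([pchar E]%R).-nat Q by rewrite pnatX qE.
set m := (q * q.-1)./2 in c_lt.
have m2 : m.*2 = q * q.-1.
  by rewrite /m halfK; case: (q) => // q'; rewrite oddM /= andNb subn0.
have m0 : 0 < m by rewrite -double_gt0 m2 muln_gt0 -subn1 subn_gt0 q1 ltnW.
have [t st] : exists t, s ^ 2 = t.+1.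
  by exists (s ^ 2).-1; rewrite prednK // expn_gt0 s0.
rewrite st in c_lt.
have [M M3] : exists M, M * 3 = Q.+1 * s.
  have : 3 %| Q.+1 * s by case/dvdnP: qQ => r ->; rewrite -mulnA dvdn_mull.
  by case/dvdnP=> M e; exists M.
pose I := half_offF E Q; pose key := @key E q Q.
have cI : #|I|.*2 = Q * Q.-1 by exact: (card_half_offF q1 Q1 qE QE qQ cE).
have inI w : w \in I -> w \in offF E Q by rewrite [w \in I]inE => /andP[].
have fU : {in I &, forall i j x y z, uniq [:: x; y; z] ->
    y \in fiber key i x -> z \in fiber key i x -> y \in fiber key j x ->
    z \in fiber key j x -> fiber key i x = fiber key j x}.
  move=> i j /inI iF /inI jF x y z U yi zi yj zj.
  have fc := fiber_cross q1 Q1 qE QE qQ cE.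
  by rewrite /key (fc i x y z) // (fc j x y z).
have thr x y z : uniq [:: x; y; z] ->
    m <= #|[set i in I | (y \in fiber key i x) && (z \in fiber key i x)]|.
  move=> U; rewrite -leq_double m2 /I -(card_half_through q1 Q1 qE QE qQ cE U).
  exact: leqnn.
have cf : {in I, forall i x, #|fiber key i x| = q.+1}.
  by move=> i /inI iF x; exact: (card_fiber_key q1 Q1 qE QE qQ cE).
have cI' := lift_coloring_in 0%R m0 cf fU thr c_lt.
have cP' := lift_coloring_proper (t0 := 0%R) m0 cf fU thr c_lt cP.
apply: (TOC_of_coloring _ M3 cI' _ cP').
- by rewrite lt0n; apply: contraTneq s0 => M0; move: M3; rewrite M0 mul0n; case: (s).
- rewrite card_Hset cardsX cardsT card_ord -st.
  have := bin3_mul6 Q; rewrite -cI => b3.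
  (* The factor 6 = 2 * 3 clears the halving in [#|I|], the third in [M] and the binomial. *)
  apply/eqP; rewrite -(eqn_pmul2r (isT : 0 < 6)); apply/eqP.
  transitivity ('C(Q.+1, 3) * 6 * s ^ 3); last by rewrite mulnAC.
  rewrite b3; transitivity (#|I|.*2 * s ^ 2 * (M * 3)); first by rewrite -muln2; ring.
  rewrite M3; ring.
Qed.

Theorem theorem4p13 (n : nat) :
  0 < n -> odd n ->
  TOC_exists 4 (7 ^ n + 1) 5 3 /\ TOC_exists 3 (8 ^ n + 1) 5 3.
Proof.
move=> _ on; split.
  (* The divisibility by 3 comes from [s = 3] here, and from 8 + 1 = 9 in the other case. *)
  exact: (@TOC_projective_line 7 1 3 n _ _ _ on _ coloring8).
exact: (@TOC_projective_line 2 3 2 n _ _ _ on _ coloring9).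
Qed.
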